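(* Let $\Omega\subset\mathbb{R}^m$ be open and convex and let $Q\ge 1$ be an integer. If $u\colon\Omega\to\mathcal{A}_Q(\mathbb{R}^n)$ is an $\ell$-Lipschitz $Q$-valued function ($\ell>0$), then the induced multisection $M_u\colon\Omega\times\mathbb{R}^n\to\mathbb{N}$ is coherent and satisfies the $\tau$-cone condition with $\tau=\ell$. Conversely, if a $Q$-multisection $M$ of the bundle $\Omega\times\mathbb{R}^n$ is coherent and satisfies the $\tau$-cone condition, then the associated $Q$-valued function $u_M\colon\Omega\to\mathcal{A}_Q(\mathbb{R}^n)$ is Lipschitz with $\mathrm{Lip}(u_M)\le\sqrt{Q}\,\tau$.
   Context: $\mathbb{N}$ includes $0$. $\mathcal{A}_Q(\mathbb{R}^n)=\{\sum_{l=1}^Q\llbracket v_l\rrbracket : v_l\in\mathbb{R}^n\}$, where $\llbracket v\rrbracket$ is the Dirac delta at $v$, with the metric $\mathcal{G}(\sum_l\llbracket v_l\rrbracket,\sum_l\llbracket w_l\rrbracket)=\big(\min_\sigma\sum_l|v_l-w_{\sigma(l)}|^2\big)^{1/2}$ over permutations $\sigma$ of $\{1,\dots,Q\}$. Lipschitz is understood with respect to $\mathcal{G}$ and the Euclidean distance on $\Omega$. A *$Q$-multisection* of the trivial bundle $\Omega\times\mathbb{R}^n$ (over $\Omega$) is a map $M\colon\Omega\times\mathbb{R}^n\to\mathbb{N}$ with $\sum_{v\in\mathbb{R}^n}M(x,v)=Q$ for every $x\in\Omega$. Its associated $Q$-valued function is $u_M(x)=\sum_{v}M(x,v)\llbracket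 v\rrbracket$. Conversely, a $Q$-valued function $u$ induces $M_u(x,v):=\Theta_{u(x)}(v)$, the multiplicity of $v$ in $u(x)$ (which is $0$ if $v\notin\mathrm{spt}(u(x))$). *Coherence:* for every $x\in\Omega$ and every disjoint family $\mathcal{V}$ of open sets $V\subset\Omega\times\mathbb{R}^n$ each containing exactly one element of $\{(x,v): M(x,v)>0\}$, there is an open neighborhood $U$ of $x$ in $\Omega$ such that for every $y\in U$ and $V\in\mathcal{V}$, $\sum_{w:(y,w)\in V}M(y,w)=M(x,v)$, where $(x,v)$ is the unique element of $V$ over $x$ with $M(x,v)>0$. *$\tau$-cone condition* ($\tau>0$ real): for every $x\in\Omega$ and every $v$ with $M(x,v)>0$ there exist neighborhoods $U$ of $x$ in $\Omega$ and $V$ of $v$ in $\mathbb{R}^n$ such that $$\{(y,w)\in U\times V : M(y,w)>0\}\subset\{(y,w)\in\mathbb{R}^m\times\mathbb{R}^n : |w-v|\le\tau|y-x|\}.$$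
   Formalization: In coherence the disjoint family is also required to cover the whole fiber over x; without this the first half fails, e.g. for the constant function [[0]]+[[1]] on R with the single open set R×(-1/2,1/2) ∪ (R\{0})×R at x=0. *)

(* Defs.v *)
From HB Require Import structures.
From mathcomp Require Import all_boot all_order all_algebra all_fingroup.
From mathcomp Require Import finmap multiset.
From mathcomp Require Import all_classical all_reals all_analysis.

Set Implicit Arguments.
Unset Strict Implicit.
Unset Printing Implicit Defensive.

Import Order.TTheory GRing.Theory Num.Theory.
Import numFieldNormedType.Exports.

Local Open Scope classical_set_scope.
Local Open Scope ring_scope.

HB.instance Definition _ (K : choiceType) :=
  Monoid.isComLaw.Build {mset K}%mset mset0 (@msetD K)
    (@msetDA K) (@msetDC K) (@mset0D K).

(* The norm that the library puts on ['rV[R]_n] is the sup norm; its topology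
   is the Euclidean one, but constants in the theorem are Euclidean. *)
Definition enorm (R : realType) (n : nat) (v : 'rV[R]_n) : R :=
  Num.sqrt (\sum_(i < n) v 0 i ^+ 2).

(* [msetn k v] is [k] times the Dirac delta at [v]. *)
Definition sum_dirac (R : realType) (n Q : nat) (v : 'I_Q -> 'rV[R]_n) :
    {mset 'rV[R]_n}%mset :=
  \big[msetD/mset0]_(l < Q) msetn 1 (v l).

Record AQ (R : realType) (n Q : nat) : Type := mkAQ {
  AQ_mset : {mset 'rV[R]_n}%mset;
  AQ_sum_dirac : exists v : 'I_Q -> 'rV[R]_n, AQ_mset = sum_dirac v }.

Lemma AQ_of_ex (R : realType) (n Q : nat) (v : 'I_Q -> 'rV[R]_n) :
  exists w : 'I_Q -> 'rV[R]_n, sum_dirac v = sum_dirac w.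
Proof. by exists v. Qed.

Definition AQ_of (R : realType) (n Q : nat) (v : 'I_Q -> 'rV[R]_n) : AQ R n Q :=
  mkAQ (AQ_of_ex v).

Definition matching_cost (R : realType) (n Q : nat) (v w : 'I_Q -> 'rV[R]_n)
    (s : {perm 'I_Q}) : R :=
  \sum_(l < Q) enorm (v l - w (s l)) ^+ 2.

Definition min_matching_cost (R : realType) (n Q : nat)
    (v w : 'I_Q -> 'rV[R]_n) : R :=
  \big[Num.min/matching_cost v w 1%g]_(s : {perm 'I_Q}) matching_cost v w s.

Definition AQ_rep (R : realType) (n Q : nat) (S : AQ R n Q) : 'I_Q -> 'rV[R]_n :=
  projT1 (cid (AQ_sum_dirac S)).

(* [distAQ_AQ_of] below: this does not depend on the chosen representatives. *)
Definition distAQ (R : realType) (n Q : nat) (S T : AQ R n Q) : R :=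
  Num.sqrt (min_matching_cost (AQ_rep S) (AQ_rep T)).

Lemma sum_diracE (R : realType) (n Q : nat) (v : 'I_Q -> 'rV[R]_n) z :
  sum_dirac v z = (\sum_(l < Q) (z == v l))%N.
Proof.
rewrite /sum_dirac (big_morph (fun S : {mset 'rV[R]_n}%mset => S z)
  (id1 := 0%N) (op1 := addn)) ?mset0E//.
  by apply: eq_bigr => l _; rewrite msetnE; case: eqP.
by move=> A B; rewrite msetE2.
Qed.

Lemma sum_dirac_seq_mset (R : realType) (n Q : nat) (v : 'I_Q -> 'rV[R]_n) :
  sum_dirac v = seq_mset [seq v l | l <- enum 'I_Q].
Proof.
apply/msetP => z; rewrite sum_diracE mset_seqE count_map -sum1_count.
rewrite big_enum_cond/= [RHS]big_mkcond; apply: eq_bigr => l _ /=.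
by rewrite eq_sym; case: eqP.
Qed.

Lemma sum_dirac_perm (R : realType) (n Q : nat) (v w : 'I_Q -> 'rV[R]_n) :
  sum_dirac v = sum_dirac w -> exists s : {perm 'I_Q}, forall l, v l = w (s l).
Proof.
rewrite !sum_dirac_seq_mset => /eq_seq_msetP pvw.
have : perm_eq [tuple v l | l < Q] [tuple w l | l < Q].
  by [].
case/tuple_permP => s /val_inj /= sE; exists s => l.
have := congr1 (fun t : Q.-tuple _ => tnth t l) sE.
by rewrite !tnth_mktuple.
Qed.

Lemma matching_cost_perm (R : realType) (n Q : nat)
    (v w : 'I_Q -> 'rV[R]_n) (s t p : {perm 'I_Q}) :
  matching_cost (v \o s) (w \o t) p = matching_cost v w (s^-1 * p * t)%g.
Proof.
rewrite /matching_cost (reindex_inj (@perm_inj _ s^-1%g)); apply: eq_bigr => l _ /=.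
by rewrite !permM permKV.
Qed.

Lemma min_matching_cost_le (R : realType) (n Q : nat)
    (v w : 'I_Q -> 'rV[R]_n) s : min_matching_cost v w <= matching_cost v w s.
Proof. by rewrite /min_matching_cost; exact: bigmin_le. Qed.

Lemma min_matching_cost_ex (R : realType) (n Q : nat) (v w : 'I_Q -> 'rV[R]_n) :
  exists s, min_matching_cost v w = matching_cost v w s.
Proof.
rewrite /min_matching_cost; elim/big_ind: _; first by exists 1%g.
- move=> a b [s ->] [t ->].
  by case: (leP (matching_cost v w s) (matching_cost v w t)) => _; [exists s|exists t].
- by move=> s _; exists s.
Qed.

Lemma distAQ_AQ_of (R : realType) (n Q : nat) (v w : 'I_Q -> 'rV[R]_n) :
  distAQ (AQ_of v) (AQ_of w) = Num.sqrt (min_matching_cost v w).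
Proof.
rewrite /distAQ /AQ_rep; case: cid => v' /= /esym/sum_dirac_perm [s sE].
case: cid => w' /= /esym/sum_dirac_perm [t tE].
have -> : v' = v \o s by apply/funext.
have -> : w' = w \o t by apply/funext.
congr Num.sqrt; apply/eqP; rewrite eq_le; apply/andP; split.
- have [p ->] := min_matching_cost_ex v w.
  have -> : p = (s^-1 * (s * p * t^-1) * t)%g by rewrite !mulgA mulVg mul1g mulgKV.
  by rewrite -matching_cost_perm; exact: min_matching_cost_le.
- have [p ->] := min_matching_cost_ex (v \o s) (w \o t).
  by rewrite matching_cost_perm; exact: min_matching_cost_le.
Qed.

Lemma size_sum_dirac (R : realType) (n Q : nat) (v : 'I_Q -> 'rV[R]_n) :
  size (sum_dirac v) = Q.
Proof.
by rewrite sum_dirac_seq_mset (perm_size (perm_eq_seq_mset _)) size_map size_enum_ord.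
Qed.

Lemma size_mset_sum_dirac (R : realType) (n Q : nat) (S : {mset 'rV[R]_n}%mset) :
  size S = Q -> exists v : 'I_Q -> 'rV[R]_n, S = sum_dirac v.
Proof.
move=> SQ; exists (fun l => nth 0 S l); rewrite sum_dirac_seq_mset.
rewrite -[LHS]seq_mset_id; congr seq_mset.
rewrite -[LHS](mkseq_nth 0) /mkseq SQ -val_enum_ord -map_comp.
exact: eq_map.
Qed.

(* Functions on [Omega] are functions on the subtype [set_type Omega], which
   the library equips with the subspace topology.  The sum over all of R^n is
   [0] when the support is infinite, so finiteness is required separately. *)
Record multisection (R : realType) (m n Q : nat) (Omega : set 'rV[R]_m) : Type :=
  mkMultisection {
    multiplicity :> Omega -> 'rV[R]_n -> nat;
    multiplicityP : forall x : Omega,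
      finite_set [set v | (0 < multiplicity x v)%N] /\
      \big[addn/0%N]_(v \in [set: 'rV[R]_n]) multiplicity x v = Q }.

Definition sum_mult (R : realType) (n : nat) (f : 'rV[R]_n -> nat) :
    {mset 'rV[R]_n}%mset :=
  \big[msetD/mset0]_(v \in [set: 'rV[R]_n]) msetn (f v) v.

Lemma preimage_neq0 (T : Type) (f : T -> nat) :
  f @^-1` [set~ 0%N] = [set v | (0 < f v)%N].
Proof. by apply/seteqP; split=> v /=; rewrite lt0n => /eqP. Qed.

Lemma sum_multE (R : realType) (n : nat) (f : 'rV[R]_n -> nat) (z : 'rV[R]_n) :
  finite_set [set v | (0 < f v)%N] -> sum_mult f z = f z.
Proof.
move=> fin; rewrite /sum_mult.
rewrite (fsbigE (fset_set [set v | (0 < f v)%N])) ?fset_uniq//; first last.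
- move=> v _; rewrite in_fset_set// notin_setE /= => /negP.
  by rewrite -eqn0Ngt => /eqP ->; rewrite msetn0.
rewrite (big_morph (fun S : {mset 'rV[R]_n}%mset => S z)
  (id1 := 0%N) (op1 := addn)) ?mset0E//; last by move=> A B; rewrite msetE2.
under eq_bigr do rewrite msetnE.
under eq_bigl do rewrite in_setT.
have [fz|] := posnP (f z).
  rewrite fz big1// => v _; case: eqP => // <-; exact: fz.
move=> fz; rewrite (bigD1_seq z) ?fset_uniq ?in_fset_set ?mem_set//= eqxx.
by rewrite big1 ?addn0// => v /negPf; rewrite eq_sym => ->.
Qed.

Lemma size_mset_fsbig (R : realType) (n : nat) (S : {mset 'rV[R]_n}%mset) :
  \big[addn/0%N]_(v \in [set: 'rV[R]_n]) S v = size S.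
Proof.
rewrite (fsbigE (finsupp S)) ?fset_uniq//; last first.
  by move=> v _ vS; rewrite (fsfun_dflt vS).
under eq_bigl do rewrite in_setT.
by rewrite -sum1_size sum_mset; apply: eq_bigr => v _; rewrite muln1.
Qed.

Lemma sum_mult_ex (R : realType) (n Q : nat) (f : 'rV[R]_n -> nat) :
  finite_set [set v | (0 < f v)%N] /\
    \big[addn/0%N]_(v \in [set: 'rV[R]_n]) f v = Q ->
  exists v : 'I_Q -> 'rV[R]_n, sum_mult f = sum_dirac v.
Proof.
move=> [fin <-]; apply: size_mset_sum_dirac; rewrite -size_mset_fsbig.
by apply: eq_fsbigr => v _; rewrite sum_multE.
Qed.

Definition assoc_fun (R : realType) (m n Q : nat) (Omega : set 'rV[R]_m)
    (M : multisection n Q Omega) (x : Omega) : AQ R n Q :=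
  mkAQ (sum_mult_ex (multiplicityP M x)).

Lemma AQ_multP (R : realType) (n Q : nat) (S : AQ R n Q) :
  finite_set [set v | (0 < AQ_mset S v)%N] /\
    \big[addn/0%N]_(v \in [set: 'rV[R]_n]) AQ_mset S v = Q.
Proof.
split; last by have [v E] := AQ_sum_dirac S; rewrite size_mset_fsbig E size_sum_dirac.
apply: (@sub_finite_set _ _ [set` finsupp (AQ_mset S)]); last exact: finite_fset.
by move=> v /=; rewrite msuppE in_mset.
Qed.

Definition induced_multisection (R : realType) (m n Q : nat)
    (Omega : set 'rV[R]_m) (u : Omega -> AQ R n Q) : multisection n Q Omega :=
  mkMultisection (fun x => AQ_multP (u x)).

Definition lipschitzAQ (R : realType) (m n Q : nat) (Omega : set 'rV[R]_m)
    (l : R) (u : Omega -> AQ R n Q) : Prop :=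
  forall x y : Omega, distAQ (u x) (u y) <= l * enorm (val x - val y).

(* [+oo] when [u] is not Lipschitz. *)
Definition Lip (R : realType) (m n Q : nat) (Omega : set 'rV[R]_m)
    (u : Omega -> AQ R n Q) : \bar R :=
  ereal_inf [set l%:E | l in [set l : R | 0 <= l /\ lipschitzAQ l u]].

Definition fiber (R : realType) (m n Q : nat) (Omega : set 'rV[R]_m)
    (M : multisection n Q Omega) (x : Omega) : set (Omega * 'rV[R]_n) :=
  [set p | p.1 = x /\ (0 < M p.1 p.2)%N].

(* The family [VV] has exactly one member for each point of the fiber over [x]:
   every member contains exactly one point of the fiber, and every point of the
   fiber lies in a member.  The second condition is needed.  Without it even
   the constant function [0] + [1] on R (Q = 2) would not be coherent at 0:
   take for [VV] the single open set
   [R * ]-1/2, 1/2[ `|` (R \ {0}) * R]. *)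
Definition coherent (R : realType) (m n Q : nat) (Omega : set 'rV[R]_m)
    (M : multisection n Q Omega) : Prop :=
  forall (x : Omega) (VV : set (set (Omega * 'rV[R]_n))),
    (forall V, VV V -> open V) ->
    trivIset VV id ->
    (forall V, VV V -> exists! p, (V `&` fiber M x) p) ->
    fiber M x `<=` \bigcup_(V in VV) V ->
    exists U : set Omega, [/\ open U, U x &
      forall y V v, U y -> VV V -> (V `&` fiber M x) (x, v) ->
        \big[addn/0%N]_(w \in [set w | V (y, w)]) M y w = M x v].

Definition cone_condition (R : realType) (m n Q : nat) (Omega : set 'rV[R]_m)
    (tau : R) (M : multisection n Q Omega) : Prop :=
  forall (x : Omega) (v : 'rV[R]_n), (0 < M x v)%N ->
    exists (U : set Omega) (V : set 'rV[R]_n), [/\ nbhs x U, nbhs v V &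
      forall y w, U y -> V w -> (0 < M y w)%N ->
        enorm (w - v) <= tau * enorm (val y - val x)].

(* Main.v *)
Require Import Defs.
From HB Require Import structures.
From mathcomp Require Import all_boot all_order all_algebra.
From mathcomp Require Import all_fingroup finmap multiset.
From mathcomp Require Import all_classical all_reals all_analysis.
From mathcomp Require Import ring.

Import Order.TTheory GRing.Theory Num.Theory.
Import numFieldNormedType.Exports.

Local Open Scope classical_set_scope.
Local Open Scope ring_scope.

(** The proof compares Q-points, the elements of [AQ R n Q], through bottleneck
    matchings: two Q-points are [matched r] when their points can be paired at
    mutual distance at most [r].  The distance G lies between the bottleneck
    distance and sqrt Q times it ([distAQ_matched], [matched_distAQ]), and this
    second inequality is the only source of the factor sqrt Q.

    If u is l-Lipschitz, every point of u(y) is paired with a point of u(x) at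
    distance at most l |y - x|.  The points of u(x) being finite in number,
    they are separated by some fixed distance, so for y close to x a point of
    u(y) near v can only be paired with v itself; this is the cone condition
    ([lipschitzAQ_cone]).  Likewise, once l |y - x| is smaller than the size of
    the given disjoint neighborhoods of the points of u(x), each neighborhood
    contains exactly the points of u(y) paired with its own point of u(x), and
    there are as many of them as the multiplicity requires
    ([lipschitzAQ_coherent]).

    For the converse, take disjoint cylinders of small radius around the points
    of the fiber over x.  By coherence, for y near x each cylinder carries over
    y the mass that it carries over x.  Since the masses over x already add up
    to Q, no mass over y is left outside the cylinders, so the points of
    u_M(y) can be paired with those of u_M(x) inside the cylinders
    ([matching_of_clusters]), where the cone condition bounds each displacement
    by tau |y - x| ([coherent_cone_matched_near]).  This bound has the same
    constant at every point x, and bottleneck matchings compose with addition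
    of the bounds, so a supremum argument along the segment from x to y,
    contained in the domain by convexity, makes it global
    ([unit_interval_chain], [coherent_cone_matched]). *)

(** * The Euclidean norm *)

Lemma enorm_ge0 {R : realType} {n : nat} (v : 'rV[R]_n) : 0 <= enorm v.
Proof. exact: sqrtr_ge0. Qed.

Lemma enorm_sq {R : realType} {n : nat} (v : 'rV[R]_n) :
  enorm v ^+ 2 = \sum_(i < n) v 0 i ^+ 2.
Proof. by rewrite sqr_sqrtr// sumr_ge0// => i _; exact: sqr_ge0. Qed.

Lemma enormZ {R : realType} {n : nat} (a : R) (v : 'rV[R]_n) :
  enorm (a *: v) = `|a| * enorm v.
Proof.
rewrite /enorm -sqrtr_sqr -sqrtrM ?sqr_ge0// mulr_sumr; congr Num.sqrt.
by apply: eq_bigr => i _; rewrite mxE exprMn.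
Qed.

Lemma enorm0 {R : realType} {n : nat} : enorm (0 : 'rV[R]_n) = 0.
Proof. by rewrite -(scale0r 0) enormZ normr0 mul0r. Qed.

Lemma enormBC {R : realType} {n : nat} (v w : 'rV[R]_n) :
  enorm (v - w) = enorm (w - v).
Proof. by rewrite -opprB -scaleN1r enormZ normrN1 mul1r. Qed.

Lemma ler_coord_enorm {R : realType} {n : nat} (v : 'rV[R]_n) (i : 'I_n) :
  `|v 0 i| <= enorm v.
Proof.
rewrite -sqrtr_sqr ler_wsqrtr// (bigD1 i)//= lerDl sumr_ge0// => j _.
exact: sqr_ge0.
Qed.

Lemma enorm_gt0 {R : realType} {n : nat} (v : 'rV[R]_n) : v != 0 -> 0 < enorm v.
Proof.
move=> v0; rewrite lt_neqAle enorm_ge0 andbT eq_sym.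
apply: contra_neq v0 => v0; apply/rowP => i; rewrite mxE.
by apply/normr0_eq0/le_anti; rewrite normr_ge0 -v0 ler_coord_enorm.
Qed.

Lemma enormD {R : realType} {n : nat} (v w : 'rV[R]_n) :
  enorm (v + w) <= enorm v + enorm w.
Proof.
have [->|/enorm_gt0 v0] := eqVneq v 0; first by rewrite enorm0 !add0r.
have [->|/enorm_gt0 w0] := eqVneq w 0; first by rewrite enorm0 !addr0.
set a := enorm v in v0 *; set b := enorm w in w0 *.
(* Weighting the two squares by the norms makes the sum of the right-hand
   sides exactly the square of [a + b]. *)
have weighted (x y : R) :
    (x + y) ^+ 2 <= (a + b) * (x ^+ 2 / a + y ^+ 2 / b).
  rewrite -subr_ge0.
  have -> : (a + b) * (x ^+ 2 / a + y ^+ 2 / b) - (x + y) ^+ 2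
      = (b * x - a * y) ^+ 2 / (a * b).
    by field; rewrite !gt_eqF.
  by rewrite divr_ge0 ?sqr_ge0// mulr_ge0// ltW.
rewrite -(@ler_pXn2r _ 2)// ?nnegrE ?enorm_ge0 ?(addr_ge0 (ltW v0))?(ltW w0)//.
have summed : enorm (v + w) ^+ 2
    <= \sum_(i < n) (a + b) * (v 0 i ^+ 2 / a + w 0 i ^+ 2 / b).
  by rewrite enorm_sq; apply: ler_sum => i _; rewrite mxE.
rewrite (le_trans summed)// -mulr_sumr big_split/= -!mulr_suml -!enorm_sq.
rewrite -/a -/b.
by rewrite !expr2 !mulfK ?gt_eqF.
Qed.

Lemma enorm_dist_triangle {R : realType} {n : nat} (u v w : 'rV[R]_n) :
  enorm (u - w) <= enorm (u - v) + enorm (v - w).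
Proof. by rewrite (le_trans _ (enormD _ _))// subrKA. Qed.

Lemma enorm_continuous {R : realType} {n : nat} : continuous (@enorm R n).
Proof.
move=> v; apply: (@continuous_comp _ _ _
  (fun w : 'rV[R]_n => \sum_(i < n) w 0 i ^+ 2) Num.sqrt); last first.
  exact: sqrt_continuous.
apply: (@cvg_big R^o _ _ _ _ (@add_continuous R^o) _ (nbhs v)) => i _.
by apply: cvgM; exact: coord_continuous.
Qed.

(** * Euclidean neighborhoods and uniform radii *)

(** The topology of ['rV[R]_n] is given by the sup norm: a sup-norm ball
    contains the Euclidean ball of the same radius, and conversely Euclidean
    balls are sup-norm neighborhoods because [enorm] is continuous. *)
Lemma nbhs_enormP {R : realType} {n : nat} (v : 'rV[R]_n) (A : set 'rV[R]_n) :
  nbhs v A <-> exists2 e : R, 0 < e & forall w, enorm (w - v) < e -> A w.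
Proof.
split=> [/nbhs_ballP[e /= e0 eA]|[e e0 eA]].
  exists e => // w wv; apply: eA; split=> // i j; rewrite ord1 /ball/=.
  rewrite distrC; apply: le_lt_trans wv.
  by have := ler_coord_enorm (w - v) j; rewrite !mxE.
have cvg0 : {for v, continuous (@enorm R n \o (fun w => w - v))}.
  apply: continuous_comp; last exact: enorm_continuous.
  by apply: (@cvgB R 'rV[R]_n _ (nbhs v) _ id (fun=> v));
    [exact: cvg_id|exact: cvg_cst].
have /= := cvgr_lt _ cvg0 e; rewrite subrr enorm0 => /(_ (nbhs_filter v) e0).
by apply: filterS => w /eA.
Qed.

Lemma nbhs_subtype_enormP {R : realType} {m : nat} {Omega : set 'rV[R]_m}
    (x : Omega) (A : set Omega) :
  nbhs x A <->
  exists2 e : R, 0 < e & forall y, enorm (val y - val x) < e -> A y.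
Proof.
split=> [[_ [[B oB <-] Bx BA]]|[e e0 eA]].
  have /nbhs_enormP[e e0 eB] : nbhs (val x) B by exact: open_nbhs_nbhs.
  by exists e => // y /eB/BA.
have ball_x : nbhs x [set y : Omega | enorm (val y - val x) < e].
  have : nbhs (val x) [set w | enorm (w - val x) < e].
    by apply/nbhs_enormP; exists e.
  exact: (@initial_continuous _ _ (@set_val _ Omega)).
by apply: filterS ball_x => y; exact: eA.
Qed.

(** The smallest of finitely many radii; it is used with the points of a
    Q-point as indices. *)
Lemma uniform_radius {R : realType} {I : finType} (P : I -> R -> Prop) :
  (forall i e e', e' <= e -> P i e -> P i e') ->
  (forall i, exists2 e, 0 < e & P i e) ->
  exists2 e, 0 < e & forall i, P i e.
Proof.
move=> Pmono /(_ _)/cid2-/all_sig2[r r0 Pr].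
exists (\big[Num.min/1]_i r i).
  by elim/big_ind : _ => // a b a0 b0; rewrite lt_min a0.
by move=> i; apply: Pmono (Pr i); exact: bigmin_le.
Qed.

Lemma open_enorm_ball {R : realType} {n : nat} (v : 'rV[R]_n) (e : R) :
  open [set w | enorm (w - v) < e].
Proof.
rewrite openE => w /= wv; apply/nbhs_enormP; exists (e - enorm (w - v)).
  by rewrite subr_gt0.
move=> z zw /=; rewrite (le_lt_trans (enorm_dist_triangle _ w _))//.
by rewrite -ltrBrDr.
Qed.

Lemma enorm_separation {R : realType} {n Q : nat} (v : 'I_Q -> 'rV[R]_n) :
  exists2 e : R, 0 < e &
    forall l l', v l <> v l' -> e + e <= enorm (v l - v l').
Proof.
have [||e e0 sep] := @uniform_radius R ('I_Q * 'I_Q)%type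
    (fun k e => v k.1 <> v k.2 -> e + e <= enorm (v k.1 - v k.2)).
- by move=> k e e' e'e sep /sep; apply: le_trans; exact: lerD.
- move=> [l l'] /=; have [vE|/eqP vl] := pselect (v l = v l').
    by exists 1.
  exists (enorm (v l - v l') / 2); last by rewrite -splitr.
  by rewrite divr_gt0// enorm_gt0// subr_eq0.
by exists e => // l l'; exact: (sep (l, l')).
Qed.

(** * Counting points of a Q-point *)

(** A sum over a set of vectors, weighted by multiplicities, becomes a count of
    indices; this is the form in which masses are compared below. *)
Lemma fsum_sum_dirac {R : realType} {n Q : nat} (v : 'I_Q -> 'rV[R]_n)
    (A : set 'rV[R]_n) :
  \big[addn/0%N]_(z \in A) sum_dirac v z = (\sum_(l < Q) (v l \in A))%N.
Proof.
pose r := [seq z <- undup (codom v) | z \in A].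
have r_uniq : uniq r by rewrite filter_uniq ?undup_uniq.
rewrite (fsbigE r)//; first last.
- move=> z Az; rewrite mem_filter mem_undup mem_set//= => zv.
  rewrite sum_diracE big1// => l _; case: eqP => // zvl.
  by rewrite zvl codom_f in zv.
- by move=> z /=; rewrite mem_filter => /andP[/set_mem].
rewrite big_seq_cond (eq_bigl (fun z => z \in r)); last first.
  by move=> z; rewrite mem_filter; case: (z \in A); rewrite ?andbF ?andbT.
rewrite -big_seq; under eq_bigr do rewrite sum_diracE.
rewrite exchange_big/=; apply: eq_bigr => l _.
transitivity (count_mem (v l) r).
  by rewrite -sum1_count [RHS]big_mkcond; apply: eq_bigr => z _ /=; case: eqP.
by rewrite count_uniq_mem// mem_filter mem_undup codom_f andbT.
Qed.

Lemma sum_dirac_gt0P {R : realType} {n Q : nat} (v : 'I_Q -> 'rV[R]_n) z :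
  (0 < sum_dirac v z)%N <-> exists l, z = v l.
Proof.
split=> [|[l ->]]; last by rewrite sum_diracE (bigD1 l)//= eqxx.
rewrite sum_diracE; apply: contraPP => /forallNP zv.
by rewrite big1// => l _; case: eqP => // /zv.
Qed.

(** Distinct points of [v] are [2e]-separated, so an [e]-ball around a point of
    [v] determines that point, and [w] splits into clusters.  As soon as every
    cluster has the size prescribed by [v], the clusters exhaust [w], and
    replacing each [w j] by the centre of its cluster gives the Q-point of [v]
    up to order. *)
Lemma matching_of_clusters {R : realType} {n Q : nat}
    (v w : 'I_Q -> 'rV[R]_n) (e : R) : 0 < e ->
  (forall l l', v l <> v l' -> e + e <= enorm (v l - v l')) ->
  (forall l, (\sum_(j < Q) (enorm (w j - v l) < e)%R = sum_dirac v (v l))%N) ->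
  exists s : {perm 'I_Q}, forall l, enorm (v l - w (s l)) < e.
Proof.
move=> e0 sep counts.
(* [f j] is the centre of the cluster of [w j]; the default [w j] makes
   [f j = v l] imply that [w j] is in the cluster of [v l] in every case. *)
pose f j := if [pick l | enorm (w j - v l) < e] is Some l then v l else w j.
have f_near j l : f j = v l -> enorm (w j - v l) < e.
  rewrite /f; case: pickP => [l' wv <-//|_ <-].
  by rewrite subrr enorm0.
have near_f j l : enorm (w j - v l) < e -> f j = v l.
  rewrite /f; case: pickP => [l' wv' wv|/(_ l)->//].
  apply: contrapT => /sep; apply/negP; rewrite -ltNge.
  rewrite (le_lt_trans (enorm_dist_triangle _ (w j) _))// ltrD//.
  by rewrite enormBC.
have dirac_f l : sum_dirac f (v l) = sum_dirac v (v l).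
  rewrite -counts sum_diracE; apply: eq_bigr => j _; congr nat_of_bool.
  by apply/eqP/idP => [/esym/f_near|/near_f/esym].
(* All of the mass [Q] of [f] sits on the range of [v]. *)
have f_range j : exists l, f j = v l.
  have : \big[addn/0%N]_(z \in range v) sum_dirac f z
       = \big[addn/0%N]_(z \in range v) sum_dirac v z.
    by apply: eq_fsbigr => z /set_mem[l _ <-].
  rewrite !fsum_sum_dirac [RHS](eq_bigr (fun=> 1%N)); last first.
    by move=> l _; rewrite mem_set//; exists l.
  move=> total; apply: contrapT => fj.
  suff : (\sum_(l < Q) (f l \in range v) < \sum_(l < Q) 1)%N.
    by rewrite total ltnn.
  rewrite (bigD1 j)//= [ltnRHS](bigD1 j)//= memNset ?add0n ?add1n.
    by rewrite ltnS leq_sum// => l _; exact: leq_b1.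
  by move=> [l _ vl]; apply: fj; exists l.
have [s sE] : exists s : {perm 'I_Q}, forall l, v l = f (s l).
  apply: sum_dirac_perm; apply/msetP => z.
  have [[l ->]|zv] := pselect (exists l, z = v l); first by rewrite dirac_f.
  rewrite !sum_diracE !big1// => l _; case: eqP => // zl; case: zv.
    by have [l' fl] := f_range l; exists l'; rewrite zl.
  by exists l.
by exists s => l; rewrite enormBC f_near.
Qed.

(** * Bottleneck matchings *)

(** [matched r S T] says that the bottleneck (L^oo-Wasserstein) distance of [S]
    and [T] is at most [r].  Unlike for the L^2 distance [distAQ], the triangle
    inequality follows from that of [enorm] one point at a time. *)
Definition matched {R : realType} {n Q : nat} (r : R) (S T : AQ R n Q) : Prop :=
  exists s : {perm 'I_Q}, forall l, enorm (AQ_rep S l - AQ_rep T (s l)) <= r.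

Lemma matched_sym {R : realType} {n Q : nat} (r : R) (S T : AQ R n Q) :
  matched r S T -> matched r T S.
Proof.
by move=> [s sr]; exists s^-1%g => l; rewrite enormBC -{2}(permKV s l).
Qed.

Lemma matched_trans {R : realType} {n Q : nat} (r r' : R) (S T P : AQ R n Q) :
  matched r S T -> matched r' T P -> matched (r + r') S P.
Proof.
move=> [s sr] [t tr]; exists (s * t)%g => l; rewrite permM.
by rewrite (le_trans (enorm_dist_triangle _ (AQ_rep T (s l)) _))// lerD.
Qed.

Lemma distAQ_matched {R : realType} {n Q : nat} (r : R) (S T : AQ R n Q) :
  distAQ S T <= r -> matched r S T.
Proof.
rewrite /distAQ; have [s ->] := min_matching_cost_ex (AQ_rep S) (AQ_rep T).
move=> cost_r; exists s => l; apply: le_trans cost_r.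
rewrite -[leLHS]ger0_norm ?enorm_ge0// -sqrtr_sqr ler_wsqrtr//.
rewrite /matching_cost (bigD1 l)//= lerDl sumr_ge0// => k _; exact: sqr_ge0.
Qed.

(** Each of the [Q] terms of the cost is at most [r ^+ 2]. *)
Lemma matched_distAQ {R : realType} {n Q : nat} (r : R) (S T : AQ R n Q) :
  0 <= r -> matched r S T -> distAQ S T <= Num.sqrt Q%:R * r.
Proof.
move=> r0 [s sr]; rewrite -[X in _ * X]ger0_norm// -sqrtr_sqr -sqrtrM//.
rewrite ler_wsqrtr// (le_trans (min_matching_cost_le _ _ s))//.
rewrite mulr_natl -[X in _ *+ X]card_ord -sumr_const.
by apply: ler_sum => l _; rewrite ler_sqr ?nnegrE ?enorm_ge0.
Qed.

Lemma AQ_repE {R : realType} {n Q : nat} (S : AQ R n Q) :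
  AQ_mset S = sum_dirac (AQ_rep S).
Proof. by rewrite /AQ_rep; case: cid. Qed.

Lemma assoc_fun_repE {R : realType} {m n Q : nat} {Omega : set 'rV[R]_m}
    (M : multisection n Q Omega) (x : Omega) (z : 'rV[R]_n) :
  M x z = sum_dirac (AQ_rep (assoc_fun M x)) z.
Proof. by rewrite -AQ_repE/= sum_multE//; case: (multiplicityP M x). Qed.

(** * Lipschitz functions induce coherent multisections with cones *)

Lemma lipschitzAQ_matched {R : realType} {m n Q : nat} {Omega : set 'rV[R]_m}
    (u : Omega -> AQ R n Q) (l : R) (x y : Omega) : lipschitzAQ l u ->
  matched (l * enorm (val y - val x)) (u x) (u y).
Proof. by move=> ul; apply: distAQ_matched; rewrite enormBC; exact: ul. Qed.

(** Let distinct points of [u x] be at least [e + e] apart.  A point [w] of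
    [u y] is paired with some point of [u x] at distance at most
    [l * enorm (y - x) < e]; if moreover [w] is [e]-close to [v], that point is
    [v]. *)
Lemma lipschitzAQ_cone {R : realType} {m n Q : nat} {Omega : set 'rV[R]_m}
    (u : Omega -> AQ R n Q) (l : R) : 0 < l -> lipschitzAQ l u ->
  cone_condition l (induced_multisection u).
Proof.
move=> l0 ul x v /=; rewrite AQ_repE => /sum_dirac_gt0P[k vE].
have [e e0 sep] := enorm_separation (AQ_rep (u x)).
exists [set y | enorm (val y - val x) < e / l], [set w | enorm (w - v) < e].
split=> [||y w /= xy vw].
- by apply/nbhs_subtype_enormP; exists (e / l); rewrite ?divr_gt0.
- by apply/nbhs_enormP; exists e.
rewrite AQ_repE => /sum_dirac_gt0P[j wE].
have [s ms] := lipschitzAQ_matched u l x y ul.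
have := ms (s^-1%g j); rewrite permKV -wE enormBC => wk.
suff -> : v = AQ_rep (u x) (s^-1%g j) by [].
rewrite vE; apply: contrapT => /sep; apply/negP; rewrite -ltNge.
rewrite (le_lt_trans (enorm_dist_triangle _ w _))// ltrD//.
  by rewrite enormBC -vE.
by rewrite (le_lt_trans wk)// mulrC -ltr_pdivlMr.
Qed.

(** A common radius [e] fits into all the chosen neighborhoods.  When both
    [enorm (y - x)] and [l * enorm (y - x)] are below [e], each point of [u y]
    lies in the neighborhood of the point of [u x] paired with it; by
    disjointness, the matching preserves the count of points in each
    neighborhood. *)
Lemma lipschitzAQ_coherent {R : realType} {m n Q : nat} {Omega : set 'rV[R]_m}
    (u : Omega -> AQ R n Q) (l : R) : 0 < l -> lipschitzAQ l u ->
  coherent (induced_multisection u).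
Proof.
move=> l0 ul x VV VVo VVtriv VV1 VVcover.
set v := AQ_rep (u x).
have fiberE z : fiber (induced_multisection u) x (x, z) <-> exists k, z = v k.
  by rewrite /fiber/= AQ_repE -sum_dirac_gt0P; split=> [[]|].
have /choice[W WP] : forall k, exists W, VV W /\ W (x, v k).
  move=> k; have [|W VVW Wk] := VVcover (x, v k); last by exists W.
  by apply/fiberE; exists k.
have [||e e0 We] := @uniform_radius R 'I_Q (fun k e => forall y w,
    enorm (val y - val x) < e -> enorm (w - v k) < e -> W k (y, w)).
- move=> k e e' e'e We y w ye' we'.
  by apply: We; [exact: lt_le_trans ye' e'e|exact: lt_le_trans we' e'e].
- move=> k; have [VVW Wk] := WP k.
  have [[A B] /= [/nbhs_subtype_enormP[a a0 Aa] /nbhs_enormP[b b0 Bb]] AB] :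
      nbhs (x, v k) (W k) by apply: open_nbhs_nbhs; split=> //; exact: VVo.
  exists (Num.min a b); first by rewrite lt_min a0.
  move=> y w; rewrite !lt_min => /andP[ya _] /andP[_ wb].
  by apply: AB; split; [exact: Aa|exact: Bb].
pose d := Num.min e (e / l).
exists [set y | enorm (val y - val x) < d]; split.
- by exists [set p | enorm (p - val x) < d]; first exact: open_enorm_ball.
- by rewrite /= subrr enorm0 lt_min e0 divr_gt0.
move=> y V z; rewrite /= lt_min => /andP[ye yl] VVV [Vz /fiberE[k0 zE]].
have [s ms] := lipschitzAQ_matched u l x y ul.
rewrite !AQ_repE fsum_sum_dirac sum_diracE.
rewrite (reindex_inj (@perm_inj _ s))/=; apply: eq_bigr => k _.
congr nat_of_bool; have [VVW Wk] := WP k.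
have Wyk : W k (y, AQ_rep (u y) (s k)).
  apply: We => //; rewrite enormBC (le_lt_trans (ms k))// mulrC.
  by rewrite -ltr_pdivlMr.
apply/idP/eqP => [/set_mem /= Vyk|zk].
- have WV : W k = V by apply: VVtriv => //; exists (y, AQ_rep (u y) (s k)).
  have [p [_ pE]] := VV1 _ VVV.
  have pk : p = (x, v k).
    by apply: pE; split; [rewrite -WV|apply/fiberE; exists k].
  have pz : p = (x, z) by apply: pE; split=> //; apply/fiberE; exists k0.
  by have := pz; rewrite pk => -[].
- have WV : W k = V.
    by apply: VVtriv => //; exists (x, v k); split; rewrite // /v -zk.
  by rewrite -WV mem_set.
Qed.

(** * From local to global along a segment *)

(** A transitive relation that holds between each point and its neighbors on
    either side relates the endpoints: if [s] is the supremum of the points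
    reachable from [0], then [s] is reachable from the left, and a further step
    to the right would pass [s] unless [s = 1]. *)
Lemma unit_interval_chain {R : realType} (step : R -> R -> Prop) :
  (forall a b c, 0 <= a -> a <= b -> b <= c -> c <= 1 ->
    step a b -> step b c -> step a c) ->
  (forall s, 0 <= s <= 1 -> exists2 d, 0 < d & forall t, 0 <= t <= 1 ->
    `|t - s| < d -> (t <= s -> step t s) /\ (s <= t -> step s t)) ->
  step 0 1.
Proof.
move=> trans loc; pose E := [set t | 0 <= t <= 1 /\ step 0 t].
have E0 : E 0.
  split; first by rewrite lexx ler01.
  have [|d d0 /(_ 0)] := loc 0; first by rewrite lexx ler01.
  by rewrite subrr normr0 lexx ler01 => /(_ isT d0)[_]; exact.
have E_ub : has_ubound E by exists 1 => t [/andP[]].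
have E_sup : has_sup E by split; first by exists 0.
set s := sup E.
have s0 : 0 <= s by exact: ub_le_sup.
have s1 : s <= 1 by apply: sup_le_ub; [exists 0|move=> t [/andP[]]].
have [|d d0 ds] := loc s; first by rewrite s0.
have step_s : step 0 s.
  have [t Et ts] := sup_adherent d0 E_sup.
  have ts' : t <= s by exact: ub_le_sup.
  have [/andP[t0 t1] step_t] := Et.
  apply: (trans 0 t s) => //; have [||+ _] := ds t; first by rewrite t0.
    by rewrite distrC ger0_norm ?subr_ge0// ltrBlDr addrC -ltrBlDr.
  exact.
pose t := Num.min 1 (s + d / 2).
have st : s <= t by rewrite le_min s1 lerDl divr_ge0// ltW.
have t1 : t <= 1 by rewrite ge_min lexx.
have step_t : step 0 t.
  apply: (trans 0 s t) => //; have [||_] := ds t; last exact.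
    by rewrite (le_trans s0 st).
  rewrite ger0_norm ?subr_ge0// ltrBlDl (@le_lt_trans _ _ (s + d / 2))//.
    by rewrite ge_min lexx orbT.
  by rewrite ltrD2l ltr_pdivrMr// ltr_pMr// ltr1n.
have : t <= s by apply: ub_le_sup => //; split=> //; rewrite (le_trans s0 st).
rewrite ge_min gerDl => /orP[s1'|]; last first.
  by rewrite leNgt divr_gt0.
by have -> : 1 = s by apply/le_anti; rewrite s1 s1'.
Qed.

(** * Coherent multisections with cones are Lipschitz *)

(** Coherence is applied to the cylinders of radius [e] around the points of the
    fiber over [x]; [e] is small enough for the cylinders to be disjoint and to
    lie within the neighborhoods of the cone condition.  Coherence provides the
    matching and the cone condition provides its quality. *)
Lemma coherent_cone_matched_near {R : realType} {m n Q : nat}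
    {Omega : set 'rV[R]_m} (M : multisection n Q Omega) (tau : R) (x : Omega) :
  coherent M -> cone_condition tau M ->
  exists2 d : R, 0 < d & forall y, enorm (val y - val x) < d ->
    matched (tau * enorm (val y - val x)) (assoc_fun M x) (assoc_fun M y).
Proof.
move=> Mcoh Mcone; set v := AQ_rep (assoc_fun M x).
have fiberE z : fiber M x (x, z) <-> exists k, z = v k.
  by rewrite /fiber/= assoc_fun_repE -sum_dirac_gt0P; split=> [[]|].
have [||c c0 cone_c] := @uniform_radius R 'I_Q (fun k c => forall y w,
    enorm (val y - val x) < c -> enorm (w - v k) < c -> (0 < M y w)%N ->
    enorm (w - v k) <= tau * enorm (val y - val x)).
- move=> k c c' c'c cone_c y w yc' wc'.
  by apply: cone_c; [exact: lt_le_trans yc' c'c|exact: lt_le_trans wc' c'c].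
- move=> k; have [|U [V [/nbhs_subtype_enormP[a a0 Ua]
      /nbhs_enormP[b b0 Vb] cone]]] := Mcone x (v k).
    by rewrite assoc_fun_repE; apply/sum_dirac_gt0P; exists k.
  exists (Num.min a b); first by rewrite lt_min a0.
  move=> y w; rewrite !lt_min => /andP[ya _] /andP[_ wb].
  by apply: cone; [exact: Ua|exact: Vb].
have [e' e'0 sep'] := enorm_separation v.
pose e := Num.min c e'.
have e0 : 0 < e by rewrite lt_min c0.
have sep l l' : v l <> v l' -> e + e <= enorm (v l - v l').
  by move=> /sep'; apply: le_trans; rewrite lerD// ge_min lexx orbT.
have share l l' w : enorm (w - v l) < e -> enorm (w - v l') < e -> v l = v l'.
  move=> wl wl'; apply: contrapT => /sep; apply/negP; rewrite -ltNge.
  by rewrite (le_lt_trans (enorm_dist_triangle _ w _))// ltrD// enormBC.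
pose B l := [set p : Omega * 'rV[R]_n | enorm (p.2 - v l) < e].
have [||||U [Uo Ux UM]] := Mcoh x (range B).
- move=> _ [l _ <-].
  apply: (@open_comp _ _ snd [set w | enorm (w - v l) < e]).
    by move=> p _; exact: cvg_snd.
  exact: open_enorm_ball.
- move=> _ _ [l _ <-] [l' _ <-] [p [/= pl pl']].
  by rewrite /B (share _ _ _ pl pl').
- move=> _ [l _ <-]; exists (x, v l); split.
    by split; [rewrite /B/= subrr enorm0|apply/fiberE; exists l].
  move=> [y w] [/= wl yw]; have yx : y = x by case: yw.
  move: yw; rewrite yx => /fiberE[l' wE]; rewrite wE; congr pair.
  by apply: (share _ _ w) => //; rewrite wE subrr enorm0.
- move=> [y w] yw; have yx : y = x by case: yw.
  move: yw; rewrite yx => /fiberE[l ->]; exists (B l); first by exists l.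
  by rewrite /B/= subrr enorm0.
have /nbhs_subtype_enormP[d d0 Ud] : nbhs x U by exact: open_nbhs_nbhs.
exists (Num.min c d); first by rewrite lt_min c0.
move=> y; rewrite lt_min => /andP[yc /Ud Uy].
have [l|s sE] := matching_of_clusters v (AQ_rep (assoc_fun M y)) e e0 sep.
  have := UM y (B l) (v l) Uy; rewrite assoc_fun_repE => <-; first last.
  - by split; [rewrite /B/= subrr enorm0|apply/fiberE; exists l].
  - by exists l.
  under [RHS]eq_fsbigr do rewrite assoc_fun_repE.
  rewrite fsum_sum_dirac; apply: eq_bigr => j _; congr nat_of_bool.
  by apply/idP/idP => [jl|/set_mem//]; rewrite mem_set.
exists s => l; rewrite enormBC; apply: cone_c => //.
  by rewrite enormBC (lt_le_trans (sE l))// ge_min lexx.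
by rewrite assoc_fun_repE; apply/sum_dirac_gt0P; exists (s l).
Qed.

(** The bound of [coherent_cone_matched_near] holds only for points near a given
    one, but with the same constant [tau] everywhere.  The bounds
    [tau * ((b - a) * L)] between parameters [a <= b] of the segment add up, so
    [unit_interval_chain] applies to them. *)
Lemma coherent_cone_matched {R : realType} {m n Q : nat}
    {Omega : set 'rV[R]_m} (M : multisection n Q Omega) (tau : R)
    (x y : Omega) : convex_set Omega -> coherent M -> cone_condition tau M ->
  matched (tau * enorm (val y - val x)) (assoc_fun M x) (assoc_fun M y).
Proof.
move=> Oconvex Mcoh Mcone; set L := enorm (val y - val x).
pose seg t := val x + t *: (val y - val x).
have seg_Omega t : 0 <= t <= 1 -> exists p : Omega, val p = seg t.
  move=> /andP[t0 t1]; suff Ot : seg t \in Omega.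
    by exists (exist (fun z => z \in Omega) _ Ot).
  have -> : seg t = t *: val y + (1 - t) *: val x.
    by rewrite /seg scalerBr scalerBl scale1r addrCA addrA.
  exact: (Oconvex (val y) (val x) (Itv01 t0 t1) (valP y) (valP x)).
have segB a b : enorm (seg b - seg a) = `|b - a| * L.
  by rewrite opprD addrACA subrr add0r -scalerBl enormZ.
have := @unit_interval_chain R (fun a b => forall p q : Omega,
  val p = seg a -> val q = seg b ->
  matched (tau * ((b - a) * L)) (assoc_fun M p) (assoc_fun M q)).
rewrite subr0 mul1r; apply.
- move=> a b c a0 ab bc c1 ab_step bc_step p q pE qE.
  have [|z zE] := seg_Omega b.
    by rewrite (le_trans a0 ab) (le_trans bc c1).
  have -> : tau * ((c - a) * L) = tau * ((b - a) * L) + tau * ((c - b) * L).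
    by ring.
  exact: matched_trans (ab_step _ _ pE zE) (bc_step _ _ zE qE).
- move=> s s01; have [z zE] := seg_Omega s s01.
  have [d d0 near_z] := coherent_cone_matched_near M tau z Mcoh Mcone.
  have L1 : 0 < L + 1 by rewrite ltr_wpDl// enorm_ge0.
  (* [L + 1] in place of [L] covers the case [x = y]. *)
  exists (d / (L + 1)); first by rewrite divr_gt0.
  move=> t t01; rewrite ltr_pdivlMr// => tsd.
  have near_t (p : Omega) : val p = seg t ->
      matched (tau * (`|t - s| * L)) (assoc_fun M z) (assoc_fun M p).
    move=> pE; rewrite -segB -pE -zE; apply: near_z; rewrite pE zE segB.
    by apply: le_lt_trans tsd; rewrite ler_wpM2l// lerDl.
  split=> ts p q pE qE.
  + have -> : q = z by apply: val_inj; rewrite qE zE.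
    apply: matched_sym; rewrite -(@ger0_norm _ (s - t)) ?subr_ge0// distrC.
    exact: near_t.
  + have -> : p = z by apply: val_inj; rewrite pE zE.
    by rewrite -(@ger0_norm _ (t - s)) ?subr_ge0//; exact: near_t.
- by rewrite /seg scale0r addr0.
- by rewrite /seg scale1r addrC subrK.
Qed.

Theorem proposition3p7 (R : realType) (m n Q : nat) (Omega : set 'rV[R]_m)
    (hopen : open Omega) (hconvex : convex_set Omega) (hQ : (1 <= Q)%N) :
  (forall (u : Omega -> AQ R n Q) (l : R), 0 < l -> lipschitzAQ l u ->
     coherent (induced_multisection u) /\
     cone_condition l (induced_multisection u)) /\
  (forall (M : multisection n Q Omega) (tau : R), 0 < tau ->
     coherent M -> cone_condition tau M ->
     (exists l : R, lipschitzAQ l (assoc_fun M)) /\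
     (Lip (assoc_fun M) <= (Num.sqrt Q%:R * tau)%:E)%E).
Proof.
split=> [u l l0 ul|M tau tau0 Mcoh Mcone].
  by split; [exact: lipschitzAQ_coherent ul|exact: lipschitzAQ_cone].
have lip : lipschitzAQ (Num.sqrt Q%:R * tau) (assoc_fun M).
  move=> x y; rewrite -mulrA enormBC; apply: matched_distAQ.
    by rewrite mulr_ge0 ?enorm_ge0// ltW.
  exact: coherent_cone_matched.
split; first by exists (Num.sqrt Q%:R * tau).
apply: ereal_inf_lbound; exists (Num.sqrt Q%:R * tau) => //; split=> //.
by rewrite mulr_ge0 ?sqrtr_ge0// ltW.
Qed.
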